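(* Let $R$ be an $n$-dimensional rectangle in $\mathbb{R}^n$, let $x\in\mathrm{int}(R)$, and let $\mathcal{P}$ be a minimal locally regulated partition of $R$ about $x$. Let $k=\beta_{\mathcal{P}}(x)$. Then there exist distinct $i_1,\dots,i_k\in\{1,\dots,n\}$ and a labelled full simple tree $T$ of $k+1$ levels such that $\mathcal{P}=\mathcal{P}(i_1,\dots,i_k;T)$.
   Context: Here $n\ge1$. An $n$-dimensional rectangle in $\mathbb{R}^n$ is a set $\prod_{i=1}^n[a_i,b_i]$ with $a_i<b_i$ for all $i$; its interior is $\prod_i(a_i,b_i)$; its faces are the subsets where one coordinate $y_i$ equals $a_i$ or equals $b_i$. A locally regulated partition of $R$ is a finite set $\mathcal{P}$ of $n$-dimensional rectangles with $\bigcup\mathcal{P}=R$ whose distinct elements have disjoint interiors. It is about $x\in\mathrm{int}(R)$ if for all $P\in\mathcal{P}$ and all faces $F$ of $P$, either $x\in F$ or $F$ is contained in a face of $R$. A standard unit vector $e_i$ is a boundary vector of $x$ with respect to $\mathcal{P}$ if there is $P=\prod_j[a_j,b_j]\in\mathcal{P}$ with $x\in P$ and $x_i\in\{a_i,b_i\}$; $\beta_{\mathcal{P}}(x)$ is the number of boundary vectors of $x$; $\nu_{\mathcal{P}}(x)$ is the number of elements of $\mathcal{P}$ containing $x$. $\mathcal{P}$ is minimal if $\nu_{\mathcal{P}}(x)=\beta_{\mathcal{P}}(x)+1$. Trees. A simple tree of $k+1$ levels ($k\ge0$) is a rooted binary tree (every node has at most two children) whose root is on level $0$, all of whose terminal nodes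 are on level $k$, and such that on each level $\ell<k$ at most one node has two children. It is full if on each level $\ell<k$ exactly one node has two children. A labelled simple tree assigns to each node a label in $\{+1,-1,0\}$: a node without a sibling (in particular the root) gets $0$; in each pair of siblings one gets $+1$ and the other $-1$. The partition $\mathcal{P}(i_1,\dots,i_k;T)$ of $R$ about $x$ (for distinct $i_1,\dots,i_k$ and a labelled full simple tree $T$ of $k+1$ levels): start with $R$ assigned to the root; at step $\ell=1,\dots,k$, the rectangle assigned to the unique node on level $\ell-1$ having two children is divided by the hyperplane $\{y:y_{i_\ell}=x_{i_\ell}\}$ into the part with $y_{i_\ell}\ge x_{i_\ell}$, assigned to the child labelled $+1$, and the part with $y_{i_\ell}\le x_{i_\ell}$, assigned to the child labelled $-1$; every other node on level $\ell-1$ passes its rectangle unchanged to its only child. Then $\mathcal{P}(i_1,\dots,i_k;T)$ is the set of rectangles assigned to the terminal nodes. Equivalently, the terminal node whose path from the root has labels $\lambda_1,\dots,\lambda_k$ on levels $1,\dots,k$ contributes $\{y\in R:\lambda_\ell(y_{i_\ell}-x_{i_\ell})\ge0\text{ for all }1\le\ell\le k\}$. *)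

(* Defs.v *)
From HB Require Import structures.
From mathcomp Require Import all_boot all_order all_algebra finmap.
From mathcomp Require Import classical_sets reals.

Set Implicit Arguments.
Unset Strict Implicit.
Unset Printing Implicit Defensive.

Import Order.TTheory GRing.Theory Num.Theory.
Local Open Scope classical_set_scope.
Local Open Scope ring_scope.

Section Rectangles.
Context {R : realType} {n : nat}.

(* A rectangle is given by its lower and upper corners a, b with a_i < b_i;
   these are determined by the set of its points, so equality of rectangles is
   equality of the sets prod_i [a_i, b_i]. *)
Record rectangle : Type := Rectangle {
  corners : 'rV[R]_n * 'rV[R]_n;
  _ : [forall i, corners.1 0 i < corners.2 0 i]
}.

HB.instance Definition _ := [isSub for corners].
HB.instance Definition _ := [Choice of rectangle by <:].

Implicit Types (A Q : rectangle) (x y : 'rV[R]_n) (i : 'I_n).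

Definition lo A : 'rV[R]_n := (corners A).1.
Definition hi A : 'rV[R]_n := (corners A).2.

Definition in_rect A x : bool := [forall i, lo A 0 i <= x 0 i <= hi A 0 i].

Definition rect_set A : set 'rV[R]_n := [set y | in_rect A y].

Definition rect_int A : set 'rV[R]_n :=
  [set y | forall i, lo A 0 i < y 0 i < hi A 0 i].

(* upper = false: the face y_i = a_i; upper = true: the face y_i = b_i *)
Definition face A i (upper : bool) : set 'rV[R]_n :=
  [set y | in_rect A y /\ y 0 i = (if upper then hi A else lo A) 0 i].

Definition locally_regulated A (P : {fset rectangle}) : Prop :=
  \bigcup_(Q in [set` P]) rect_set Q = rect_set A /\
  {in P &, forall Q Q', Q != Q' -> rect_int Q `&` rect_int Q' = set0}.

Definition partition_about A (P : {fset rectangle}) x : Prop :=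
  {in P, forall Q, forall i upper,
    face Q i upper x \/ exists j upper', face Q i upper `<=` face A j upper'}.

(* e_i is a boundary vector of x with respect to P *)
Definition boundary_vector (P : {fset rectangle}) x i : bool :=
  [exists Q : P, in_rect (val Q) x &&
     ((x 0 i == lo (val Q) 0 i) || (x 0 i == hi (val Q) 0 i))].

Definition beta (P : {fset rectangle}) x : nat :=
  #|[set i | boundary_vector P x i]%SET|.

Definition nu (P : {fset rectangle}) x : nat :=
  #|` [fset Q in P | in_rect Q x]%fset|.

Definition minimal_partition (P : {fset rectangle}) x : Prop :=
  nu P x = (beta P x).+1.

End Rectangles.

Arguments rectangle R n : clear implicits.

(* Rooted trees with at most two children per node; every node carries an
   integer, its label. *)
Inductive ltree : Type :=
| Leaf of int
| Node1 of int & ltree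
| Node2 of int & ltree & ltree.

Definition label (T : ltree) : int :=
  match T with Leaf l | Node1 l _ | Node2 l _ _ => l end.

Definition has_two_children (T : ltree) : bool :=
  if T is Node2 _ _ _ then true else false.

(* The nodes on level l, each represented by the subtree rooted at it. *)
Fixpoint nodes_on (l : nat) (T : ltree) : seq ltree :=
  match l, T with
  | 0%N, _ => [:: T]
  | l'.+1, Leaf _ => [::]
  | l'.+1, Node1 _ T1 => nodes_on l' T1
  | l'.+1, Node2 _ T1 T2 => nodes_on l' T1 ++ nodes_on l' T2
  end.

Fixpoint terminal_levels (T : ltree) : seq nat :=
  match T with
  | Leaf _ => [:: 0%N]
  | Node1 _ T1 => map S (terminal_levels T1)
  | Node2 _ T1 T2 => map S (terminal_levels T1 ++ terminal_levels T2)
  end.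

Definition simple_tree (k : nat) (T : ltree) : Prop :=
  all (pred1 k) (terminal_levels T) /\
  forall l, (l < k)%N -> (count has_two_children (nodes_on l T) <= 1)%N.

Definition full_simple_tree (k : nat) (T : ltree) : Prop :=
  simple_tree k T /\
  forall l, (l < k)%N -> count has_two_children (nodes_on l T) = 1%N.

Fixpoint labelled_below (T : ltree) : bool :=
  match T with
  | Leaf _ => true
  | Node1 _ T1 => (label T1 == 0) && labelled_below T1
  | Node2 _ T1 T2 =>
      [&& ((label T1, label T2) == (1, -1)) || ((label T1, label T2) == (-1, 1)),
          labelled_below T1 & labelled_below T2]
  end.

Definition labelled (T : ltree) : bool := (label T == 0) && labelled_below T.

Section TreePartition.
Context {R : realType} {n : nat}.
Implicit Types (x y : 'rV[R]_n) (i : 'I_n) (B : set 'rV[R]_n).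

(* The part y_i >= x_i of B if l = 1, the part y_i <= x_i of B if l = -1. *)
Definition half x i (l : int) B : set 'rV[R]_n :=
  B `&` [set y | 0 <= l%:~R * (y 0 i - x 0 i)].

(* The sets assigned to the terminal nodes when B is assigned to the root and
   the branching nodes on successive levels are divided along the coordinates
   listed in s. The last case is a default value: it does not occur when s has
   as many entries as T has levels below the root. *)
Fixpoint terminal_rects x (s : seq 'I_n) (T : ltree) B : set (set 'rV[R]_n) :=
  match T, s with
  | Leaf _, _ => [set B]
  | Node1 _ T1, _ :: s' => terminal_rects x s' T1 B
  | Node2 _ T1 T2, i :: s' =>
      terminal_rects x s' T1 (half x i (label T1) B) `|`
      terminal_rects x s' T2 (half x i (label T2) B)
  | _, [::] => set0
  end.

Definition tree_partition (A : rectangle R n) x (s : seq 'I_n) (T : ltree) :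
    set (set 'rV[R]_n) :=
  terminal_rects x s T (rect_set A).

End TreePartition.

(* Main.v *)
Require Import Defs.
From mathcomp Require Import all_boot all_order all_algebra finmap.
From mathcomp Require Import classical_sets reals.
From mathcomp Require Import lra.

(** Every cell of a partition about [x] contains [x], and in each direction [i]
    its side is the whole side of [A], the part of it above [x_i] or the part
    of it below [x_i] ([cell_lo], [cell_hi], [cell_center]). A cell is thus
    encoded by a subcube of the discrete cube [{ffun 'I_n -> bool}]: a
    coordinate is either free or fixed to one of two values. The cells become a
    partition of the discrete cube into subcubes ([cell_cubes_partition]), the
    boundary vectors of [x] become the coordinates fixed by some subcube, and
    minimality says that there are exactly [k + 1] subcubes, where [k] is the
    number of those coordinates. It remains to show that such a partition comes
    from successive bisections, each along a new coordinate.

    View a subcube [c] as a vector with entries in [{1, -1, 0}] and let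
    [form c z] be its scalar product with [z]. Given [z] nonzero on some fixed
    coordinate, take a subcube fixing a coordinate in the support of [z], choose
    one of its points and change it on that support to the signs of [z]. The
    new point lies in a subcube that agrees with the signs of [z]; this one
    must fix a coordinate of the support, since otherwise it would meet the
    original subcube. So some form is positive at [z] and, with [- z], some
    form is negative at [z] ([exists_form_gt0], [exists_form_lt0]). As an
    underdetermined homogeneous system has a nonzero solution, all forms but
    one could vanish at a suitable [z] if there were at most [k] subcubes: hence
    there are at least [k + 1] ([mentioned_lt]). If there are exactly [k + 1],
    then for two given subcubes [c] and [d] all other forms vanish at some
    [z <> 0]. The support [S] of [z] then has the following properties
    ([separator]): [c] and [d] agree off [S] and nowhere fix the same value on
    [S], and every subcube fixing a coordinate in [S] also fixes all values that
    [c] fixes off [S].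

    Let now [c] fix as many coordinates as possible, let [p] be a point of [c],
    and for each coordinate [i] fixed by [c] let [d_i] be the subcube containing
    [p] with its [i]-th coordinate flipped, and [S_i] a separator of [c] and
    [d_i]. If [i] is chosen so that [S_i] contains as few coordinates fixed by
    [c] as possible, then [i] is the only one, so [d_i] fixes the coordinates of
    [c], to the same values except at [i], and by maximality no others
    ([exists_siblings]). Merging [c] and
    [d_i] gives a partition with one subcube less; by [mentioned_lt] it mentions
    one coordinate less, which can only be [i] ([mentioned_merge]). By induction
    the merged partition comes from a tree, in which the leaf of the merged
    subcube is then split along [i] ([cube_partition_tree]). *)

Set Implicit Arguments.
Unset Strict Implicit.
Unset Printing Implicit Defensive.

Import Order.TTheory GRing.Theory Num.Theory.

Local Open Scope ring_scope.

(** * Partitions of the discrete cube into subcubes *)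

Section Cubes.
Variable I : finType.

(** A subcube of [{ffun I -> bool}]: coordinate [i] is free where the value is
    [None], and fixed to [b] where it is [Some b]. *)
Definition cube := {ffun I -> option bool}.

Implicit Types (c d e : cube) (p q : {ffun I -> bool}) (F : {set cube}).

Definition in_cube c p := [forall i, (c i == None) || (c i == Some (p i))].

(** The fixed coordinates of a subcube. *)
Definition support c : {set I} := [set i | c i != None]%SET.

(** The coordinates fixed by at least one member of [F]. *)
Definition mentioned F : {set I} := (\bigcup_(c in F) support c)%SET.

(** Every point of the discrete cube lies in exactly one member of [F]. *)
Definition cube_partition F :=
  (forall p, exists2 c, c \in F & in_cube c p) /\
  (forall c d p, c \in F -> d \in F -> in_cube c p -> in_cube d p -> c = d).

Definition whole_cube : cube := [ffun=> None].

Definition fix_coord c i (b : bool) : cube :=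
  [ffun j => if j == i then Some b else c j].

Definition free_coord c i : cube := [ffun j => if j == i then None else c j].

Lemma in_cubeP c p :
  reflect (forall i b, c i = Some b -> b = p i) (in_cube c p).
Proof.
apply: (iffP forallP) => [h i b cib|h i].
  by move: (h i); rewrite cib /= => /eqP[].
by case E: (c i) => [b|] //=; rewrite (h _ _ E).
Qed.

(** The point of [c] whose free coordinates are [true]. *)
Definition some_point c : {ffun I -> bool} := [ffun i => odflt true (c i)].

Lemma some_pointP c : in_cube c (some_point c).
Proof. by apply/in_cubeP => i b cib; rewrite ffunE cib. Qed.

Lemma mentionedP F i :
  reflect (exists2 c, c \in F & c i != None) (i \in mentioned F).
Proof.
by apply: (iffP bigcupP) => -[c cF ci]; exists c => //; move: ci; rewrite inE.
Qed.

(** * Linear forms attached to the cubes of a partition *)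

Definition sign_of (o : option bool) : rat :=
  if o is Some b then (if b then 1 else -1) else 0.

(** The scalar product of [z] with the sign vector of [c], in which a free
    coordinate counts as [0]. *)
Definition form c (z : I -> rat) : rat := \sum_i sign_of (c i) * z i.

Lemma formN c z : form c (fun i => - z i) = - form c z.
Proof. by rewrite /form -sumrN; apply: eq_bigr => i _; rewrite mulrN. Qed.

Lemma form_neq0 c z : form c z != 0 -> exists2 i, z i != 0 & c i != None.
Proof.
move=> cz.
case: (pickP (fun i => (z i != 0) && (c i != None))) => [i /andP[]|no].
  by exists i.
case/eqP: cz; rewrite /form big1 // => i _.
move: (no i); have [->|] := eqVneq (z i) 0; rewrite ?mulr0 //=.
by case: (c i) => //; rewrite mul0r.
Qed.

(** On the support of [z], each value fixed by [c] is the sign of [z]. *)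
Definition agrees c (z : I -> rat) :=
  forall i b, z i != 0 -> c i = Some b -> b = (0 < z i).

Lemma agrees_form_gt0 c z i :
  agrees c z -> z i != 0 -> c i != None -> 0 < form c z.
Proof.
move=> cz zi ci.
have ge0 j : 0 <= sign_of (c j) * z j.
  have [->|zj] := eqVneq (z j) 0; first by rewrite mulr0.
  case E: (c j) => [b|] /=; last by rewrite mul0r.
  rewrite (cz j b zj E); case: ltP => [/ltW|]; first by rewrite mul1r.
  by rewrite mulN1r oppr_ge0.
rewrite /form (bigD1 i) //= ltr_wpDr ?sumr_ge0 // lt0r ge0 andbT mulf_neq0 //.
by case: (c i) ci => [[]|].
Qed.

(** If [c] fixes a coordinate in the support of [z] and [p] is in [c], then a
    member [d] of the partition agrees with [z], has a positive form, and is
    compatible with [p] off the support. *)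
Lemma mentioning_projection F c z i p :
    cube_partition F -> c \in F -> z i != 0 -> c i != None -> in_cube c p ->
  exists d, [/\ d \in F, agrees d z, 0 < form d z
    & forall j b, z j = 0 -> d j = Some b -> b = p j].
Proof.
move=> [cov hit] cF zi ci cp.
pose q := [ffun j => if z j == 0 then p j else 0 < z j].
have [d dF /in_cubeP dq] := cov q.
have dz : agrees d z by move=> j b zj /dq ->; rewrite ffunE (negPf zj).
have dp j b : z j = 0 -> d j = Some b -> b = p j.
  by move=> zj /dq ->; rewrite ffunE zj eqxx.
exists d; split => //.
case: (pickP (fun j => (z j != 0) && (d j != None))) => [j /andP[zj dj]|no].
  exact: agrees_form_gt0 dj.
(* otherwise d fixes nothing on the support, so it contains p, like c *)
have dc : d = c.
  apply: hit dF cF _ cp; apply/in_cubeP => j b djb; apply: dp (djb).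
  by move: (no j); rewrite djb andbT => /negbFE/eqP.
by move: (no i); rewrite zi dc ci.
Qed.

Lemma exists_form_gt0 F z i :
    cube_partition F -> i \in mentioned F -> z i != 0 ->
  exists d, [/\ d \in F, agrees d z & 0 < form d z].
Proof.
move=> hF /mentionedP[c cF ci] zi.
by have [d [dF dz d0 _]] :=
  mentioning_projection hF cF zi ci (some_pointP c); exists d.
Qed.

Lemma exists_form_lt0 F z i :
    cube_partition F -> i \in mentioned F -> z i != 0 ->
  exists d, [/\ d \in F, agrees d (fun j => - z j) & form d z < 0].
Proof.
move=> hF iV zi; have [|d [dF dz]] :=
  exists_form_gt0 (z := fun j => - z j) hF iV; first by rewrite oppr_eq0.
by rewrite formN oppr_gt0 => d0; exists d.
Qed.

(** A homogeneous linear system with fewer equations (the members of [E]) than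
    unknowns (the coordinates in [V]) has a nonzero solution. *)
Lemma underdetermined (E : {set cube}) (V : {set I}) : (#|E| < #|V|)%N ->
  exists z : I -> rat, (exists2 i, i \in V & z i != 0) /\
    {in E, forall c, form c z = 0}.
Proof.
move=> ltEV.
pose M : 'M[rat]_(#|V|, #|E|) :=
  \matrix_(i < #|V|, j < #|E|) sign_of ((enum_val j : cube) (enum_val i)).
have : kermx M != 0.
  by rewrite -mxrank_eq0 mxrank_ker subn_eq0 -ltnNge
    (leq_ltn_trans (rank_leq_col M)).
case/rowV0Pn => v /sub_kermxP vM /rV0Pn[i0 vi0].
(* the solution v extended by 0 outside V *)
pose z i := \sum_(a | enum_val a == i) v 0 a.
have zE a : z (enum_val a) = v 0 a.
  rewrite /z (big_pred1 a) // => b.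
  by rewrite /= (inj_eq enum_val_inj).
exists z; split; first by exists (enum_val i0); rewrite ?enum_valP ?zE.
move=> c cE; have /rowP/(_ (enum_rank_in cE c)) := vM.
rewrite !mxE => <-; rewrite /form [RHS](eq_bigr (fun a =>
    sign_of (c (enum_val a)) * z (enum_val a))); last first.
  by move=> a _; rewrite !mxE enum_rankK_in // mulrC zE.
rewrite -(big_enum_val (fun i => sign_of (c i) * z i)) /=.
rewrite [LHS](bigID (mem V)) /= [X in _ + X]big1 ?addr0 // => i iV.
rewrite /z big_pred0 ?mulr0 // => a.
by apply: contraNF iV => /eqP <-; apply: enum_valP.
Qed.

(** A partition mentioning [k] coordinates has at least [k + 1] members:
    otherwise all forms but one would vanish at some nonzero [z], although one
    form is positive and another is negative at [z]. *)
Lemma mentioned_lt F : cube_partition F -> (#|mentioned F| < #|F|)%N.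
Proof.
move=> hF; rewrite ltnNge; apply/negP => le.
have [c0 c0F _] := hF.1 [ffun=> true].
have lt : (#|F :\ c0| < #|mentioned F|)%N.
  by apply: leq_trans le; rewrite [leqRHS](cardsD1 c0) c0F.
have [z [[i iV zi] z0]] := underdetermined lt.
have [d [dF _ d0]] := exists_form_gt0 hF iV zi.
have [e [eF _ e0]] := exists_form_lt0 hF iV zi.
have only a : a \in F -> form a z != 0 -> a = c0.
  move=> aF; apply: contraNeq => ac0; rewrite z0 //.
  by rewrite in_setD1 ac0.
have dc0 : d = c0 by apply: only; rewrite ?gt_eqF.
have ec0 : e = c0 by apply: only; rewrite ?lt_eqF.
by move: (lt_trans e0 d0); rewrite dc0 ec0 ltxx.
Qed.

(** [S] is the support of a vector at which only the forms of [c] and [d] do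
    not vanish. In the tree to be found, it stands for the coordinates used at
    or below the node where the paths to [c] and [d] part. *)
Lemma separator F c d : cube_partition F -> #|F| = #|mentioned F|.+1 ->
    c \in F -> d \in F -> c != d ->
  exists S : {set I},
    [/\ forall e i j, e \in F -> i \in S -> e i != None ->
          j \notin S -> c j != None -> e j = c j,
        forall j, j \notin S -> c j = d j
      & forall j, j \in S -> c j != None -> d j != None -> c j != d j].
Proof.
move=> hF cardF cF dF cd.
have lt : (#|F :\ c :\ d| < #|mentioned F|)%N.
  rewrite -ltnS -cardF [ltnRHS](cardsD1 c) cF [in ltnRHS](cardsD1 d).
  by rewrite in_setD1 eq_sym cd dF !add1n.
have [z0 [[i0 i0V z0i] z00]] := underdetermined lt.
(* up to exchanging z0 and its opposite, the form is positive at c *)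
have [z [[i iV zi] [cz dz conly donly]]] : exists z : I -> rat,
    (exists2 i, i \in mentioned F & z i != 0) /\
    [/\ agrees c z, agrees d (fun i => - z i),
        forall e, e \in F -> 0 < form e z -> e = c
      & forall e, e \in F -> form e z < 0 -> e = d].
  have zero a z : (forall e, e \in F :\ c :\ d -> form e z = 0) ->
      a \in F -> form a z != 0 -> a = c \/ a = d.
    move=> zz aF an; have [->|ac] := eqVneq a c; first by left.
    have [->|ad] := eqVneq a d; first by right.
    by rewrite zz ?eqxx // !inE ac ad in an.
  have aux (z : I -> rat) i : i \in mentioned F -> z i != 0 -> 0 < form c z ->
      (forall e, e \in F :\ c :\ d -> form e z = 0) ->
      [/\ agrees c z, agrees d (fun i => - z i),
        forall e, e \in F -> 0 < form e z -> e = c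
      & forall e, e \in F -> form e z < 0 -> e = d].
    move=> iV zi c0 zz.
    have [e [eF ez e0]] := exists_form_lt0 hF iV zi.
    have donly a : a \in F -> form a z < 0 -> a = d.
      move=> aF a0; case: (zero a z zz aF) => // [|ac]; first by rewrite lt_eqF.
      by move: (lt_trans a0 c0); rewrite ac ltxx.
    have ed := donly e eF e0; rewrite ed in ez e0.
    have conly a : a \in F -> 0 < form a z -> a = c.
      move=> aF a0; case: (zero a z zz aF) => // [|ad]; first by rewrite gt_eqF.
      by move: (lt_trans e0 a0); rewrite ad ltxx.
    split=> //.
    have [a [aF az a0]] := exists_form_gt0 hF iV zi.
    by rewrite -(conly a aF a0).
  have zN e : e \in F :\ c :\ d -> form e (fun i => - z0 i) = 0.
    by move=> eF; rewrite formN z00 ?oppr0.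
  have [e [eF ez e0]] := exists_form_gt0 hF i0V z0i.
  have [f [fF fz f0]] := exists_form_lt0 hF i0V z0i.
  have [c0|c0|c0] := ltgtP (form c z0) 0.
  - exists (fun i => - z0 i); split; first by exists i0; rewrite ?oppr_eq0.
    by apply: (aux _ i0); rewrite ?oppr_eq0 // formN oppr_gt0.
  - by exists z0; split; [exists i0|apply: (aux _ i0)].
  have ed : e = d.
    case: (zero e z0 z00 eF) => // [|ec]; first by rewrite gt_eqF.
    by rewrite ec c0 ltxx in e0.
  have fd : f = d.
    case: (zero f z0 z00 fF) => // [|ec]; first by rewrite lt_eqF.
    by rewrite ec c0 ltxx in f0.
  by move: (lt_trans f0 e0); rewrite ed fd ltxx.
(* a cube e fixing a coordinate in the support fixes what a fixes off it: by
   mentioning_projection, a is compatible off the support with every point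
   of e *)
have ext a w : (forall e, e \in F -> 0 < form e w -> e = a) ->
    forall e i j, e \in F -> w i != 0 -> e i != None -> w j = 0 ->
      a j != None -> e j = a j.
  move=> aonly e k j eF wk ek wj; case aj: (a j) => [b|] // _.
  have ext1 p : in_cube e p -> b = p j.
    move=> ep; have [g [gF _ g0 gp]] := mentioning_projection hF eF wk ek ep.
    by apply: gp wj _; rewrite (aonly g gF g0).
  case ej: (e j) => [b'|].
    by rewrite (ext1 _ (some_pointP e)) ffunE ej.
  pose p := [ffun l => if l == j then ~~ b else some_point e l].
  have /ext1 : in_cube e p.
    apply/in_cubeP => l b'; rewrite ffunE; case: eqP => [->|_]; rewrite ?ej //.
    by move: (some_pointP e) => /in_cubeP; apply.
  by rewrite ffunE eqxx; case: (b).
have dN e : e \in F -> 0 < form e (fun i => - z i) -> e = d.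
  by move=> eF; rewrite formN oppr_gt0; apply: donly.
have extc := ext c z conly.
have extd := ext d (fun i => - z i) dN.
have neg (w : I -> rat) j : (- w j != 0) = (w j != 0) by rewrite oppr_eq0.
have [k zk ck] : exists2 j, z j != 0 & c j != None.
  have [e [eF _ e0]] := exists_form_gt0 hF iV zi.
  by rewrite -(conly e eF e0); apply: form_neq0; rewrite gt_eqF.
have [l zl dl] : exists2 j, z j != 0 & d j != None.
  have [e [eF _ e0]] := exists_form_lt0 hF iV zi.
  by rewrite -(donly e eF e0); apply: form_neq0; rewrite lt_eqF.
exists [set j | z j != 0]%SET; split.
- move=> e k' j eF; rewrite !inE negbK => zk' ek' /eqP zj.
  exact: (extc e k' j eF zk' ek' zj).
- move=> j; rewrite inE negbK => /eqP zj.
  have [cj|cj] := eqVneq (c j) None; last by rewrite (extc d l j).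
  have [dj|dj] := eqVneq (d j) None; first by rewrite cj.
  by rewrite (extd c k j) // ?neg // zj oppr0.
- move=> j; rewrite inE => zj.
  case cj: (c j) => [b|] //; case dj: (d j) => [b'|] // _ _.
  rewrite (cz j b zj cj) (dz j b' _ dj) ?neg // oppr_gt0.
  by case: ltgtP zj => // ->; rewrite eqxx.
Qed.

(** * Sibling cubes *)

(** Two members of the partition differ only by the value to which they fix one
    coordinate. *)
Lemma exists_siblings F : cube_partition F -> #|F| = #|mentioned F|.+1 ->
    (0 < #|mentioned F|)%N ->
  exists c i, [/\ c i = None, fix_coord c i true \in F
    & fix_coord c i false \in F].
Proof.
move=> hF cardF /card_gt0P[i0 /mentionedP[c0 c0F c0i]].
have [c cF cmax] : exists2 c, c \in F &
    forall d, d \in F -> (#|support d| <= #|support c|)%N.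
  case: (@arg_maxnP _ c0 (mem F) (fun c => #|support c|) c0F) => c cF h.
  by exists c.
have [i1 i1c] : exists i, i \in support c.
  apply/card_gt0P; apply: leq_trans (cmax _ c0F); apply/card_gt0P.
  by exists i0; rewrite inE.
pose p := some_point c; have cp : in_cube c p := some_pointP c.
pose flip i : {ffun I -> bool} := [ffun j => (j == i) (+) p j].
(* nb i is the cube across the facet of c at i, next to the point p *)
have [nb nbP] : exists nb : I -> cube,
    forall i, (nb i \in F) && in_cube (nb i) (flip i).
  apply: (@fin_all_exists _ (fun=> cube)
    (fun i d => (d \in F) && in_cube d (flip i))) => i.
  by have [d dF dp] := hF.1 (flip i); exists d; rewrite dF.
have nbF i : nb i \in F by case/andP: (nbP i).
have nbE i j b : nb i j = Some b -> b = (j == i) (+) p j.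
  by case/andP: (nbP i) => _ /in_cubeP h /h; rewrite ffunE.
have pE j b : c j = Some b -> p j = b by rewrite ffunE => ->.
have nbi i : i \in support c -> exists b, c i = Some b /\ nb i i = Some (~~ b).
  rewrite inE; case ci: (c i) => [b|] // _; exists b; split=> //.
  case E: (nb i i) => [b'|]; first by rewrite (nbE _ _ _ E) eqxx (pE _ _ ci).
  (* otherwise nb i would contain p and coincide with c *)
  have nc : nb i = c.
    apply: hF.2 (nbF i) cF _ cp; apply/in_cubeP => j b' jb'.
    rewrite (nbE _ _ _ jb'); case: eqP jb' => // ->.
    by rewrite E.
  by rewrite nc ci in E.
have nbj i j : j != i -> j \in support c -> nb i j != None -> nb i j = c j.
  move=> ji; rewrite inE; case cj: (c j) => [b|] // _.
  case E: (nb i j) => [b'|] // _.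
  by rewrite (nbE _ _ _ E) (negPf ji) (pE _ _ cj).
have sep i : exists S : {set I}, i \in support c ->
    [/\ forall e k j, e \in F -> k \in S -> e k != None ->
          j \notin S -> c j != None -> e j = c j,
        forall j, j \notin S -> c j = nb i j
      & forall j, j \in S -> c j != None -> nb i j != None -> c j != nb i j].
  have [ic|] := boolP (i \in support c); last by exists (support c).
  have [|S hS] := separator hF cardF cF (nbF i) _; last by exists S.
  have [b [cb nbb]] := nbi i ic.
  by apply/eqP => E; move: nbb; rewrite -E cb; case: (b).
have {sep}[S hS] := fin_all_exists sep.
case: (@arg_minnP _ i1 (mem (support c))
  (fun i => #|S i :&: support c|) i1c) => i.
rewrite -[mem _ i]/(i \in support c) => ic imin.
have [b [cib nib]] := nbi i ic.
have [extS eqS neS] := hS i ic.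
have iS k : k \in support c -> k \in S k.
  move=> kc; have [b' [cb' nb']] := nbi k kc.
  have [_ eqk _] := hS k kc.
  by apply: contraT => /eqk; rewrite cb' nb'; case: (b').
(* for another fixed coordinate j in S i, the set S j would contain fewer
   coordinates fixed by c than S i *)
have single j : j \in S i -> j \in support c -> j = i.
  move=> jS jc; apply/eqP/negPn/negP => ji.
  have [_ _ neSj] := hS j jc.
  have cj : c j != None by rewrite inE in jc.
  have ci : c i != None by rewrite cib.
  have ij : i != j by rewrite eq_sym.
  have nij : nb i j = None.
    apply/eqP/negPn/negP => h; have := neS j jS cj h.
    by rewrite (nbj i j) ?eqxx.
  have [bj [cbj nbbj]] := nbi j jc.
  have nji : nb j i != None.
    apply/eqP => nji.
    (* otherwise flipping p at both i and j gives a common point *)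
    pose q : {ffun I -> bool} := [ffun k => [|| k == i | k == j] (+) p k].
    have E : nb i = nb j.
      apply: (hF.2 _ _ q) => //; apply/in_cubeP => k b' kb';
        rewrite (nbE _ _ _ kb') [q k]ffunE.
        case: (eqVneq k j) kb' => [->|_ _]; first by rewrite nij.
        by rewrite orbF.
      by case: (eqVneq k i) kb' => [->|//]; rewrite nji.
    by move: nij; rewrite E nbbj.
  have iSj : i \notin S j.
    apply/negP => h; have := neSj i h ci nji.
    by rewrite (nbj j i) ?eqxx.
  have : S j :&: support c \proper S i :&: support c.
    apply/properP; split; last first.
      by exists i; rewrite finset.in_setI ?(negPf iSj) // ic iS.
    apply/fintype.subsetP => k; rewrite !finset.in_setI => /andP[kS kc].
    rewrite kc andbT.
    apply: contraT => kSi.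
    have ck : c k != None by rewrite inE in kc.
    have njk : nb j k = c k by apply: (extS _ j) => //; rewrite nbbj.
    by have := neSj k kS ck; rewrite njk ck eqxx => /(_ isT).
  by move/proper_card; rewrite ltnNge imin.
(* hence nb i fixes every coordinate fixed by c, and by maximality no other *)
have sub : support c \subset support (nb i).
  apply/fintype.subsetP => j jc; have [jS|jS] := boolP (j \in S i).
    by rewrite (single j jS jc) inE nib.
  by rewrite inE -eqS //; rewrite inE in jc.
have supE : support c = support (nb i).
  by apply/eqP; rewrite eqEcard sub cmax.
have nE j : j != i -> nb i j = c j.
  move=> ji; have [jc|jc] := boolP (j \in support c).
    by apply: nbj => //; move: jc; rewrite supE inE.
  have : j \notin support (nb i) by rewrite -supE.
  by move: jc; rewrite !inE !negbK => /eqP-> /eqP->.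
exists (free_coord c i), i; rewrite ffunE eqxx; split=> //.
  suff: (if b then c else nb i) = fix_coord (free_coord c i) i true.
    by move=> <-; case: ifP.
  apply/ffunP => j; rewrite !ffunE; case: eqVneq => [->|ji].
    by case: (b) cib nib.
  by case: (b); rewrite ?nE.
suff: (if b then nb i else c) = fix_coord (free_coord c i) i false.
  by move=> <-; case: ifP.
apply/ffunP => j; rewrite !ffunE; case: eqVneq => [->|ji].
  by case: (b) cib nib.
by case: (b); rewrite ?nE.
Qed.

(** [F] with the two halves of [c] along coordinate [i] replaced by [c]. *)
Definition merge F c i : {set cube} :=
  (c |: F :\ fix_coord c i true :\ fix_coord c i false)%SET.

Lemma in_free c i p : c i = None ->
  in_cube c p = in_cube (fix_coord c i (p i)) p.
Proof.
move=> ci; apply/in_cubeP/in_cubeP => h j b; last first.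
  move=> cj; apply: h; rewrite ffunE; case: eqP cj => [->|//].
  by rewrite ci.
by rewrite ffunE; case: eqP => [-> []|_ /h].
Qed.

Section Merge.
Variables (F : {set cube}) (c : cube) (i : I).
Hypotheses (hF : cube_partition F) (ci : c i = None).
Hypotheses (cT : fix_coord c i true \in F) (cN : fix_coord c i false \in F).

Lemma fix_in b : fix_coord c i b \in F.
Proof. by case: b. Qed.

Lemma fix_neq : fix_coord c i true != fix_coord c i false.
Proof. by apply/eqP => /ffunP/(_ i); rewrite !ffunE eqxx. Qed.

Lemma in_merge d : d \in merge F c i =
  (d == c) || [&& d \in F, d != fix_coord c i true & d != fix_coord c i false].
Proof.
by rewrite !inE; congr orb; do !case: (_ == _); rewrite ?andbF ?andbT.
Qed.

Lemma c_notin : c \notin F.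
Proof.
apply/negP => cF; have := some_pointP c; rewrite (in_free _ ci) => h.
have := hF.2 _ _ _ cF (fix_in _) (some_pointP c) h.
by move/ffunP/(_ i); rewrite ffunE eqxx ci.
Qed.

Lemma merge_partition : cube_partition (merge F c i).
Proof.
have one d p : d \in F -> in_cube c p -> in_cube d p ->
    d = fix_coord c i (p i).
  move=> dF; rewrite (in_free _ ci) => cp dp.
  by apply: hF.2 dp cp; rewrite ?fix_in.
split=> [p|d e p].
  have [cp|ncp] := boolP (in_cube c p).
    by exists c => //; rewrite in_merge eqxx.
  have [d dF dp] := hF.1 p; exists d => //; rewrite in_merge dF.
  have ne b : d != fix_coord c i b.
    apply: contraNneq ncp => E; rewrite (in_free _ ci).
    move: (dp); rewrite E => /in_cubeP/(_ i b); rewrite ffunE eqxx => <- //.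
    by rewrite -E.
  by rewrite !ne orbT.
rewrite !in_merge => /orP[/eqP->|/and3P[dF dT dN]]
  /orP[/eqP->|/and3P[eF eT eN]] //.
- move=> cp ep; have E := one e p eF cp ep.
  by case: (p i) E => E; rewrite E eqxx in eT eN.
- move=> dp cp; have E := one d p dF cp dp.
  by case: (p i) E => E; rewrite E eqxx in dT dN.
- exact: hF.2.
Qed.

Lemma card_merge : #|F| = #|merge F c i|.+1.
Proof.
have cNN : c \notin (F :\ fix_coord c i true :\ fix_coord c i false)%SET.
  by rewrite !in_setD1 (negPf c_notin) !andbF.
rewrite (cardsD1 (fix_coord c i true)) cT.
rewrite (cardsD1 (fix_coord c i false)) in_setD1 eq_sym fix_neq cN.
by rewrite /merge cardsU1 cNN.
Qed.

Lemma mentioned_merge : #|F| = #|mentioned F|.+1 ->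
  mentioned (merge F c i) = (mentioned F :\ i)%SET.
Proof.
move=> cardF.
have iF : i \in mentioned F.
  by apply/mentionedP; exists (fix_coord c i true); rewrite // ffunE eqxx.
have sub : mentioned F :\ i \subset mentioned (merge F c i).
  apply/fintype.subsetP => j.
  rewrite in_setD1 => /andP[ji /mentionedP[d dF dj]].
  apply/mentionedP.
  have viac b : d = fix_coord c i b ->
      exists2 e, e \in merge F c i & e j != None.
    move=> E; exists c; first by rewrite in_merge eqxx.
    by move: dj; rewrite E ffunE (negPf ji).
  have [/viac//|dT] := eqVneq d (fix_coord c i true).
  have [/viac//|dN] := eqVneq d (fix_coord c i false).
  by exists d; rewrite // in_merge dF dT dN orbT.
apply/esym/eqP; rewrite eqEcard sub -ltnS.
have := mentioned_lt merge_partition; move: card_merge; rewrite cardF => -[<-].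
by rewrite [X in (_ < X)%N](cardsD1 i) iF.
Qed.

End Merge.

(** * Trees of subcubes *)

(** The subcubes at the terminal nodes of [T], from left to right, when [c] is
    at the root and the branching nodes on successive levels fix the coordinates
    listed in [s]; a child labelled [1] gets the value [true]. *)
Fixpoint leaf_cubes (s : seq I) (T : ltree) (c : cube) : seq cube :=
  match T, s with
  | Leaf _, _ => [:: c]
  | Node1 _ T1, _ :: s' => leaf_cubes s' T1 c
  | Node2 _ T1 T2, i :: s' =>
      leaf_cubes s' T1 (fix_coord c i (label T1 == 1)) ++
      leaf_cubes s' T2 (fix_coord c i (label T2 == 1))
  | _, [::] => [::]
  end.

(** [T] with one more level: each terminal node whose subcube is [m] gets two
    children, each other terminal node gets one. *)
Fixpoint grow (m : cube) (s : seq I) (T : ltree) (c : cube) : ltree :=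
  match T, s with
  | Leaf l, _ =>
      if c == m then Node2 l (Leaf 1) (Leaf (-1)) else Node1 l (Leaf 0)
  | Node1 l T1, _ :: s' => Node1 l (grow m s' T1 c)
  | Node2 l T1 T2, i :: s' =>
      Node2 l (grow m s' T1 (fix_coord c i (label T1 == 1)))
              (grow m s' T2 (fix_coord c i (label T2 == 1)))
  | _, [::] => T
  end.

Lemma label_grow m s T c : label (grow m s T c) = label T.
Proof. by case: T s => [l|l T|l T1 T2] [|i s] //=; case: ifP. Qed.

Lemma labelled_grow m s T c : labelled_below T -> labelled_below (grow m s T c).
Proof.
elim: T s c => [l|l T1 IH1|l T1 IH1 T2 IH2] [|i s] c //=; try by case: ifP.
  by case/andP=> l0 h; rewrite label_grow l0 IH1.
by case/and3P=> l0 h1 h2; rewrite !label_grow l0 IH1 ?IH2.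
Qed.

(** All terminal nodes of [T] are on level [k]. *)
Definition deep k T := all (pred1 k) (terminal_levels T).

Lemma all_pred1_mapS k s : all (pred1 k.+1) (map S s) = all (pred1 k) s.
Proof. by rewrite all_map. Qed.

Lemma all_pred1_map0 s : all (pred1 0%N) (map S s) = (s == [::]).
Proof. by case: s. Qed.

Lemma terminal_levels_neq0 T : terminal_levels T != [::].
Proof.
elim: T => //= [_ T|_ T1 + T2 _]; first by case: terminal_levels.
by case: terminal_levels.
Qed.

Lemma deep_grow m s T c : deep (size s) T -> deep (size s).+1 (grow m s T c).
Proof.
rewrite /deep.
elim: T s c => [l|l T1 IH1|l T1 IH1 T2 IH2] [|i s] c //=; try by case: ifP.
- by rewrite all_pred1_map0 (negPf (terminal_levels_neq0 _)).
- by rewrite !all_pred1_mapS => /IH1.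
- by rewrite all_pred1_map0; case: terminal_levels (terminal_levels_neq0 T1).
- by rewrite !all_pred1_mapS !all_cat => /andP[/IH1-> /IH2->].
Qed.

Lemma count_two_children_grow_lt m s T c l :
    deep (size s) T -> (l < size s)%N ->
  count has_two_children (nodes_on l (grow m s T c)) =
  count has_two_children (nodes_on l T).
Proof.
rewrite /deep.
elim: T s c l => [l|l T1 IH1|l T1 IH1 T2 IH2] [|i s] c [|k] //=.
  by rewrite !all_pred1_mapS ltnS => /IH1 h /h.
rewrite !all_pred1_mapS all_cat ltnS => /andP[/IH1 h1 /IH2 h2] ks.
by rewrite !count_cat h1 ?h2.
Qed.

Lemma count_two_children_grow_last m s T c : deep (size s) T ->
  count has_two_children (nodes_on (size s) (grow m s T c)) =
  count_mem m (leaf_cubes s T c).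
Proof.
rewrite /deep.
elim: T s c => [l|l T1 IH1|l T1 IH1 T2 IH2] [|i s] c //=.
- by case: ifP.
- by rewrite !all_pred1_mapS => /IH1.
- by rewrite all_pred1_map0; case: terminal_levels (terminal_levels_neq0 T1).
- rewrite !all_pred1_mapS all_cat => /andP[/IH1 h1 /IH2 h2].
  by rewrite !count_cat h1 h2.
Qed.

Lemma leaf_cubes_grow m s i T c : deep (size s) T ->
  leaf_cubes (rcons s i) (grow m s T c) c =
  flatten [seq if d == m then [:: fix_coord m i true; fix_coord m i false]
               else [:: d] | d <- leaf_cubes s T c].
Proof.
rewrite /deep.
elim: T s c => [l|l T1 IH1|l T1 IH1 T2 IH2] [|j s] c //=.
- by case: eqP => [->|].
- by rewrite all_pred1_map0 (negPf (terminal_levels_neq0 _)).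
- by rewrite !all_pred1_mapS => /IH1.
- by rewrite all_pred1_map0; case: terminal_levels (terminal_levels_neq0 T1).
- rewrite !all_pred1_mapS all_cat => /andP[/IH1 h1 /IH2 h2].
  by rewrite !label_grow h1 h2 map_cat flatten_cat.
Qed.

(** A partition with [k + 1] members mentioning [k] coordinates consists of the
    subcubes at the terminal nodes of a labelled full simple tree that branches
    along distinct mentioned coordinates. *)
Lemma cube_partition_tree k F : cube_partition F ->
    #|mentioned F| = k -> #|F| = k.+1 ->
  exists s T, [/\ size s = k /\ uniq s, {subset s <= mentioned F},
    full_simple_tree k T, labelled T
    & perm_eq (leaf_cubes s T whole_cube) (enum F)].
Proof.
elim: k F => [|k IH] F hF kF cardF.
  have /cards1P[c Fc] : #|F| == 1%N by rewrite cardF.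
  have cE : c = whole_cube.
    apply/ffunP => i; rewrite ffunE; apply/eqP/negPn/negP => ci.
    have : i \in mentioned F by apply/mentionedP; exists c; rewrite ?Fc ?set11.
    by rewrite (cards0_eq kF) inE.
  exists [::], (Leaf 0); split=> //.
  by rewrite Fc enum_set1 cE.
have cF : #|F| = #|mentioned F|.+1 by rewrite kF.
have [|c [i [ci cT cN]]] := exists_siblings hF cF; first by rewrite kF.
have mE := mentioned_merge hF ci cT cN cF.
have iF : i \in mentioned F.
  by apply/mentionedP; exists (fix_coord c i true); rewrite // ffunE eqxx.
have [||s [T [[sk us] sF [[Td _] Tf] /andP[T0 Tl] pe]]] :=
  IH _ (merge_partition hF ci cT cN).
- by apply: succn_inj; rewrite mE -kF [in RHS](cardsD1 i) iF.
- by apply: succn_inj; rewrite -(card_merge hF ci cT cN).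
have deepT : deep (size s) T by rewrite sk.
have full l : (l < k.+1)%N ->
    count has_two_children (nodes_on l (grow c s T whole_cube)) = 1%N.
  rewrite ltnS leq_eqVlt => /orP[/eqP->|lk]; last first.
    by rewrite count_two_children_grow_lt ?sk // Tf.
  rewrite -sk count_two_children_grow_last // (permP pe).
  rewrite count_uniq_mem ?enum_uniq //.
  by rewrite mem_enum in_merge eqxx.
exists (rcons s i), (grow c s T whole_cube); split.
- rewrite size_rcons sk rcons_uniq us andbT; split=> //.
  by apply/negP => /sF; rewrite mE in_setD1 eqxx.
- move=> j; rewrite mem_rcons in_cons => /orP[/eqP->//|/sF].
  by rewrite mE in_setD1 => /andP[].
- split=> //; split; last by move=> l /full ->.
  by rewrite -sk; apply: deep_grow.
- by rewrite /labelled label_grow T0 labelled_grow.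
rewrite leaf_cubes_grow //.
have /permPl-> := perm_flatten (perm_map
  (fun d => if d == c then [:: fix_coord c i true; fix_coord c i false]
            else [:: d]) pe).
set L := flatten _.
have LE : L =i enum F.
  move=> d; rewrite mem_enum; apply/flatten_mapP/idP => [[e]|dF].
    rewrite mem_enum in_merge; case: eqVneq => [_ _|_ /= /and3P[eF _ _]].
      by rewrite !inE => /orP[]/eqP->.
    by rewrite inE => /eqP->.
  have cM : c \in enum (merge F c i) by rewrite mem_enum in_merge eqxx.
  have [->|dT] := eqVneq d (fix_coord c i true).
    by exists c; rewrite // eqxx !inE eqxx.
  have [->|dN] := eqVneq d (fix_coord c i false).
    by exists c; rewrite // eqxx !inE eqxx orbT.
  exists d; first by rewrite mem_enum in_merge dF dT dN orbT.
  have [dc|_] := eqVneq d c; last by rewrite inE.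
  by move: (c_notin hF ci cT cN); rewrite -dc dF.
have sizeL r : size (flatten [seq if d == c then
      [:: fix_coord c i true; fix_coord c i false] else [:: d] | d <- r]) =
    (size r + count_mem c r)%N.
  elim: r => //= d r IHr; rewrite size_cat IHr.
  by case: eqP => _ /=; rewrite ?addSn ?addnS.
apply: uniq_perm; rewrite ?enum_uniq //.
apply: (leq_size_uniq (enum_uniq (mem F))) => [d|]; first by rewrite LE.
rewrite sizeL count_uniq_mem ?enum_uniq // mem_enum in_merge eqxx addn1.
by rewrite -!cardE -(card_merge hF ci cT cN).
Qed.

End Cubes.

(** * Rectangles as subcubes *)

Section Geometry.
Context {R : realType} {n : nat}.
Implicit Types (A Q : rectangle R n) (x y : 'rV[R]_n) (c : cube 'I_n).

(** The subcube encoding [Q]: coordinate [i] is fixed to [true] if [Q] starts at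
    [x_i], and to [false] if [Q] ends at [x_i]. *)
Definition rect_cube x Q : cube 'I_n :=
  [ffun i => if lo Q 0 i == x 0 i then Some true
             else if hi Q 0 i == x 0 i then Some false else None].

Local Open Scope classical_set_scope.

(** The part of [A] encoded by a subcube: above [x_i] where coordinate [i] is
    fixed to [true], and below [x_i] where it is fixed to [false]. *)
Definition cube_set A x c : set 'rV[R]_n :=
  [set y | in_rect A y /\ forall i b, c i = Some b ->
     if b then x 0 i <= y 0 i else y 0 i <= x 0 i].

Lemma rectP A i : lo A 0 i < hi A 0 i.
Proof. by case: A => p /= h; exact: (forallP h i). Qed.

Lemma half_cube A x c i (l : int) : (l == 1) || (l == -1) -> c i = None ->
  Defs.half x i l (cube_set A x c) = cube_set A x (fix_coord c i (l == 1)).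
Proof.
move=> hl ci.
have lE y : (0 <= l%:~R * (y 0 i - x 0 i)) =
    (if l == 1 then x 0 i <= y 0 i else y 0 i <= x 0 i).
  case/orP: hl => /eqP-> /=; first by rewrite mul1r subr_ge0.
  by rewrite mulrN1z mulN1r oppr_ge0 subr_le0.
apply/seteqP; split=> y /=.
  move=> [[yA yc]]; rewrite /= lE => yi; split=> // j b.
  by rewrite ffunE; case: eqP => [-> [<-]|_ /yc].
move=> [yA yc]; split; first split=> // j b cj.
  by apply: yc; rewrite ffunE; case: eqP cj => // ->; rewrite ci.
by rewrite /= lE; apply: yc; rewrite ffunE eqxx.
Qed.

Lemma terminal_rects_cubes A x s T c :
    labelled_below T -> uniq s -> (forall i, i \in s -> c i = None) ->
  terminal_rects x s T (cube_set A x c) =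
  [set cube_set A x d | d in [set` leaf_cubes s T c]].
Proof.
elim: T s c => [l|l T1 IH1|l T1 IH1 T2 IH2] s c /=.
- move=> _ _ _; case: s => [|i s]; apply/seteqP; split=> B /=;
    try by move=> ->; exists c; rewrite //= inE.
  + by move=> [d]; rewrite /= inE => /eqP-> <-.
  + by move=> [d]; rewrite /= inE => /eqP-> <-.
- case: s => [|i s] /=; first by move=> *; apply/seteqP; split=> B // [].
  case/andP=> _ h /andP[_ us] hc; apply: IH1 => // j js; apply: hc.
  by rewrite inE js orbT.
case: s => [|i s] /=; first by move=> *; apply/seteqP; split=> B // [].
case/and3P=> hl h1 h2 /andP[is_ us] hc.
have ci : c i = None by apply: hc; rewrite mem_head.
have hc' b j : j \in s -> fix_coord c i b j = None.
  move=> js; rewrite ffunE; case: eqP => [ji|_].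
    by rewrite -ji js in is_.
  by apply: hc; rewrite inE js orbT.
have [l1 l2] : ((label T1 == 1) || (label T1 == -1)) /\
               ((label T2 == 1) || (label T2 == -1)).
  by case/orP: hl => /eqP[-> ->].
rewrite !half_cube // IH1 ?IH2 //; try exact: hc'.
apply/seteqP; split=> B /=.
  by move=> [[d /= dL <-]|[d /= dL <-]]; exists d; rewrite //= mem_cat dL ?orbT.
move=> [d]; rewrite /= mem_cat => /orP[dL|dL] <-; [left|right]; by exists d.
Qed.

(** The vertex of [Q] that is upper in the directions where [u] holds. *)
Definition box_vertex Q (u : 'I_n -> bool) : 'rV[R]_n :=
  \row_k (if u k then hi Q else lo Q) 0 k.

Lemma box_vertex_in Q u : in_rect Q (box_vertex Q u).
Proof.
apply/forallP => k; rewrite mxE; have h := ltW (rectP Q k).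
by case: (u k); rewrite lexx h.
Qed.

Lemma sub_corners Q A i : rect_set Q `<=` rect_set A ->
  lo A 0 i <= lo Q 0 i /\ hi Q 0 i <= hi A 0 i.
Proof.
move=> sub; split.
  have /sub/forallP/(_ i) := box_vertex_in Q (fun=> false).
  by rewrite mxE => /andP[].
have /sub/forallP/(_ i) := box_vertex_in Q (fun=> true).
by rewrite mxE => /andP[].
Qed.

(** A face of [Q] contained in a face of [A] lies on the same side of [A]: [Q]
    has positive length in all directions, so the two faces are orthogonal to
    the same axis, and on the same side of it. *)
Lemma face_sub_eq Q A i j u u' : rect_set Q `<=` rect_set A ->
    face Q i u `<=` face A j u' ->
  (if u then hi Q else lo Q) 0 i = (if u then hi A else lo A) 0 i.
Proof.
move=> sub fsub.
have value w : (if (if j == i then u else w) then hi Q else lo Q) 0 j =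
    (if u' then hi A else lo A) 0 j.
  pose v k := if k == i then u else w.
  have /fsub[_] : face Q i u (box_vertex Q v).
    by split; [apply: box_vertex_in|rewrite mxE /v eqxx].
  by rewrite mxE.
have [ji|ji] := eqVneq j i; last first.
  have := value true; have := value false; rewrite (negPf ji) => <- /eqP.
  by rewrite gt_eqF // rectP.
have := value true; rewrite ji eqxx.
have [h1 h2] := sub_corners i sub; have h := rectP Q i.
case: (u) (u') => [] [] // E.
  by move: h; rewrite E ltNge h1.
by move: h; rewrite E ltNge h2.
Qed.

Section Partition.
Variables (A : rectangle R n) (x : 'rV[R]_n) (P : {fset rectangle R n}).
Hypotheses (hx : rect_int A x) (hP : locally_regulated A P).
Hypothesis habout : partition_about A P x.

Lemma cell_sub Q : Q \in P -> rect_set Q `<=` rect_set A.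
Proof. by move=> QP y Qy; rewrite -hP.1; exists Q. Qed.

Lemma cell_side Q i (u : bool) : Q \in P ->
  (if u then hi Q else lo Q) 0 i = (if u then hi A else lo A) 0 i \/
  (if u then hi Q else lo Q) 0 i = x 0 i.
Proof.
move=> QP; have [[_ <-]|[j [u' h]]] := habout QP i u; first by right.
by left; apply: face_sub_eq h; apply: cell_sub.
Qed.

Lemma cell_lo Q i : Q \in P ->
  lo Q 0 i = if rect_cube x Q i == Some true then x 0 i else lo A 0 i.
Proof.
move=> QP; rewrite ffunE; case: (eqVneq (lo Q 0 i)) => // /eqP ne.
have [E|/ne//] := cell_side i false QP.
by case: (_ == x 0 i).
Qed.

Lemma cell_hi Q i : Q \in P ->
  hi Q 0 i = if rect_cube x Q i == Some false then x 0 i else hi A 0 i.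
Proof.
move=> QP; rewrite ffunE; have [E|E] := cell_side i true QP; last first.
  rewrite -E eqxx; case: (eqVneq (lo Q 0 i)) => // e.
  by have := rectP Q i; rewrite e ltxx.
have /andP[_ xi] := hx i.
by rewrite /= in E; rewrite E (gt_eqF xi); case: (_ == x 0 i).
Qed.

Lemma in_cell Q y : Q \in P ->
  in_rect Q y <-> cube_set A x (rect_cube x Q) y.
Proof.
move=> QP; split=> [Qy|[/forallP yA yc]].
  split; first exact: (cell_sub QP).
  move=> i b cb; move/forallP/(_ i): Qy.
  rewrite (cell_lo i QP) (cell_hi i QP) cb.
  by case: (b) => /andP[].
apply/forallP => i; have := yA i; have := yc i.
rewrite (cell_lo i QP) (cell_hi i QP).
case: (rect_cube x Q i) => [b|] //= /(_ b erefl).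
by case: b => /= -> /andP[h1 h2]; rewrite ?h1 ?h2.
Qed.

Lemma cell_setE Q : Q \in P -> rect_set Q = cube_set A x (rect_cube x Q).
Proof. by move=> QP; apply/seteqP; split=> y /(in_cell _ QP). Qed.

Lemma cell_center Q : Q \in P -> in_rect Q x.
Proof.
move=> QP; apply/(in_cell _ QP); split; last by move=> i [].
by apply/forallP => i; case/andP: (hx i) => /ltW-> /ltW->.
Qed.

Lemma rect_cube_inj : {in P &, injective (rect_cube x)}.
Proof.
move=> Q Q' QP Q'P E; apply: val_inj.
rewrite [val Q]surjective_pairing [val Q']surjective_pairing.
congr pair; apply/rowP => i.
  by have := cell_lo i QP; rewrite E -(cell_lo i Q'P).
by have := cell_hi i QP; rewrite E -(cell_hi i Q'P).
Qed.

(** The subcubes encoding the rectangles of [P]. *)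
Definition cell_cubes : {set cube 'I_n} :=
  [set rect_cube x (val Q) | Q : P]%SET.

Lemma cell_cubesP c :
  reflect (exists2 Q, Q \in P & c = rect_cube x Q) (c \in cell_cubes).
Proof.
apply: (iffP imsetP) => [[Q _ ->]|[Q QP ->]].
  by exists (val Q); rewrite ?fsvalP.
by exists [` QP]%fset.
Qed.

Lemma card_cell_cubes : #|cell_cubes| = nu P x.
Proof.
rewrite card_imset; last first.
  by move=> Q Q' /rect_cube_inj h; apply: val_inj; apply: h; apply: fsvalP.
rewrite -cardfE /nu; congr #|` _|; apply/fsetP => Q.
by rewrite !inE /=; case: (boolP (Q \in P)) => //= /cell_center ->.
Qed.

Lemma mentioned_cell_cubes :
  mentioned cell_cubes = [set i | boundary_vector P x i]%SET.
Proof.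
apply/setP => i; rewrite [in RHS]inE.
have E Q : (rect_cube x Q i != None) =
    (x 0 i == lo Q 0 i) || (x 0 i == hi Q 0 i).
  rewrite ffunE ![x 0 i == _]eq_sym.
  by case: (lo Q 0 i == _) => //; case: (hi Q 0 i == _).
apply/mentionedP/existsP => [[c /cell_cubesP[Q QP ->]]|[Q /andP[_]]].
  by rewrite E => h; exists [` QP]%fset; rewrite /= h cell_center.
rewrite -E => h; exists (rect_cube x (val Q)) => //.
by apply/cell_cubesP; exists (val Q); rewrite ?fsvalP.
Qed.

Lemma cell_cubes_partition : cube_partition cell_cubes.
Proof.
split=> [p|c d p].
  (* p is contained in the subcube of any rectangle that contains the vertex of
     A in the direction p *)
  have : rect_set A (box_vertex A p) by exact: box_vertex_in.
  rewrite -hP.1 => -[Q /= QP /(in_cell _ QP)[_ yc]].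
  exists (rect_cube x Q); first by apply/cell_cubesP; exists Q.
  apply/in_cubeP => i b /yc; rewrite mxE; have /andP[h1 h2] := hx i.
  by case: b; case: (p i) => //; rewrite leNgt ?h1 ?h2.
move=> /cell_cubesP[Q QP ->] /cell_cubesP[Q' Q'P ->] cp dp.
congr (rect_cube x _); apply/eqP/negPn/negP => ne.
(* halfway from x to the vertex of A in the direction p, a point interior to
   both Q and Q' *)
pose y := 2^-1 *: (x + box_vertex A p).
have yint T : T \in P -> in_cube (rect_cube x T) p -> rect_int T y.
  move=> TP /in_cubeP Tp i; have /andP[h1 h2] := hx i.
  rewrite (cell_lo i TP) (cell_hi i TP) !mxE.
  have := Tp i; case: (rect_cube x T i) => [[]|] //=.
  - by move=> /(_ _ erefl) <-; apply/andP; split; lra.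
  - by move=> /(_ _ erefl) <-; apply/andP; split; lra.
  - by case: (p i) => _; apply/andP; split; lra.
have : (rect_int Q `&` rect_int Q') y by split; apply: yint.
by rewrite hP.2.
Qed.

End Partition.
End Geometry.

Local Open Scope classical_set_scope.
Local Open Scope ring_scope.

Theorem theorem3p9 (R : realType) (n : nat) (hn : (0 < n)%N)
    (A : rectangle R n) (x : 'rV[R]_n) (hx : rect_int A x)
    (P : {fset rectangle R n})
    (hP : locally_regulated A P)
    (habout : partition_about A P x)
    (hmin : minimal_partition P x) :
  exists (s : (beta P x).-tuple 'I_n) (T : ltree),
    [/\ uniq s, full_simple_tree (beta P x) T, labelled T
      & [set rect_set Q | Q in [set` P]] = tree_partition A x s T].
Proof.
have cb : #|mentioned (cell_cubes x P)| = beta P x.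
  by rewrite (mentioned_cell_cubes hx hP habout).
have cn : #|cell_cubes x P| = (beta P x).+1.
  by rewrite (card_cell_cubes hx hP habout).
have [s [T [[sk us] _ fT lT pe]]] :=
  cube_partition_tree (cell_cubes_partition hx hP habout) cb cn.
have sE : size s == beta P x by rewrite sk.
exists (Tuple sE), T; split=> //.
have AE : rect_set A = cube_set A x (whole_cube _).
  by apply/seteqP; split=> y; [split=> // i b; rewrite ffunE|case].
rewrite /tree_partition AE terminal_rects_cubes //=; first last.
- by move=> i _; rewrite ffunE.
- by case/andP: lT.
apply/seteqP; split=> B /= [].
  move=> Q QP <-; exists (rect_cube x Q); last first.
    by rewrite (cell_setE hx hP habout).
  by rewrite /= (perm_mem pe) mem_enum; apply/cell_cubesP; exists Q.
move=> c; rewrite /= (perm_mem pe) mem_enum => /cell_cubesP[Q QP ->] <-.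
by exists Q; rewrite // (cell_setE hx hP habout).
Qed.
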